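(* Let $r\ge1$, $k_1,\dots,k_r\in\mathbb{Z}$, $a$ a complex number that is not an integer $\le r-1$, and $n\ge0$. Then $$B_{n,a}^{(k_1,\ldots,k_r)}(x)=\sum_{0\le m_1\le m_2\le\cdots\le m_r\le n}\frac{m_r!\,W_{-1,xr}(n,m_r)}{(m_1+a-r+1)^{k_1}(m_2+a-r+2)^{k_2}\cdots(m_r+a)^{k_r}}.$$
   Context: For a positive integer $r$, integers $k_1,\dots,k_r$ and $a$ as stated, the Hurwitz-Lerch multiple zeta function is the formal power series $$\Phi_{(k_1,\ldots,k_r)}(z,a)=\sum_{0\le m_1\le m_2\le\cdots\le m_r}\frac{z^{m_r}}{(m_1+a-r+1)^{k_1}(m_2+a-r+2)^{k_2}\cdots(m_r+a)^{k_r}},$$ and the Hurwitz-Lerch type multi poly-Bernoulli polynomials are defined by $\Phi_{(k_1,\ldots,k_r)}(1-e^{-t},a)\,e^{rxt}=\sum_{n\ge0}B_{n,a}^{(k_1,\ldots,k_r)}(x)\frac{t^n}{n!}$. The $r$-Whitney numbers of the second kind $W_{m,\rho}(n,k)$ are defined by $\sum_{n\ge k}W_{m,\rho}(n,k)\frac{z^n}{n!}=\frac{e^{\rho z}}{k!}\left(\frac{e^{mz}-1}{m}\right)^k$ (with $W_{m,\rho}(n,k)=0$ for $n<k$); here $m=-1$ and $\rho=xr$. *)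

(* Defs.v *)
From HB Require Import structures.
From mathcomp Require Import all_boot all_order all_algebra.
From mathcomp Require Import reals complex.
Set Implicit Arguments.
Unset Strict Implicit.
Unset Printing Implicit Defensive.
Import Order.TTheory GRing.Theory Num.Theory.
Local Open Scope ring_scope.

(* A formal power series is its sequence of coefficients. *)
Definition fps (A : Type) : Type := nat -> A.

Section FormalPowerSeries.
Variable A : comUnitRingType.
Implicit Types (f g : fps A) (c : A).

Definition fps_one : fps A := fun n => (n == 0%N)%:R.

Definition fps_sub f g : fps A := fun n => f n - g n.

Definition fps_scale c f : fps A := fun n => c * f n.

Definition fps_mul f g : fps A := fun n => \sum_(i < n.+1) f i * g (n - i)%N.

Definition fps_exp f (j : nat) : fps A := iter j (fps_mul f) fps_one.

(* f(g(t)), for g with zero constant term: then g^j has no term of degree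
   n < j, so that truncating the sum over j at n loses nothing. *)
Definition fps_comp f g : fps A :=
  fun n => \sum_(j < n.+1) f j * fps_exp g j n.

(* e^{c t}; the factorials must be units of A. *)
Definition fps_expS c : fps A := fun n => c ^+ n / n`!%:R.

(* The numbers b_n such that f(t) = \sum_n b_n t^n / n!. *)
Definition egf_coef f (n : nat) : A := n`!%:R * f n.

(* W_{m,rho}(n,k); it vanishes for n < k, see r_whitney2_small. *)
Definition r_whitney2 (m rho : A) (n k : nat) : A :=
  egf_coef
    (fps_scale (k`!%:R)^-1
       (fps_mul (fps_expS rho)
          (fps_exp (fps_scale m^-1 (fps_sub (fps_expS m) fps_one)) k))) n.

Lemma fps_exp_small g (j n : nat) : g 0%N = 0 -> (n < j)%N -> fps_exp g j n = 0.
Proof.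
move=> g0; elim: j n => // j IHj n lt_nj.
rewrite /fps_exp iterS /fps_mul big1 // => -[[|i] /= lt_in] _.
  by rewrite g0 mul0r.
rewrite [iter _ _ _ _]IHj ?mulr0 //.
case: n lt_nj lt_in => // n lt_nj _.
by rewrite subSS (leq_ltn_trans (leq_subr _ _)).
Qed.

Lemma r_whitney2_small (m rho : A) (n k : nat) :
  (n < k)%N -> r_whitney2 m rho n k = 0.
Proof.
move=> lt_nk; rewrite /r_whitney2 /egf_coef /fps_scale /fps_mul big1 ?mulr0 //.
move=> i _; rewrite fps_exp_small ?mulr0 //.
  by rewrite /fps_sub /fps_expS /fps_one expr0 fact0 divr1 subrr mulr0.
by rewrite (leq_ltn_trans (leq_subr _ _)).
Qed.

End FormalPowerSeries.

Section HurwitzLerch.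
Variables (F : fieldType) (r : nat).
Implicit Types (k : r.-tuple int) (a : F).

(* (m_1+a-r+1)^{k_1} ... (m_r+a)^{k_r}; the index i : 'I_r starts at 0. *)
Definition hl_denom N k a (m : r.-tuple 'I_N) : F :=
  \prod_(i < r) ((tnth m i)%:R + a - r%:R + i.+1%:R) ^ tnth k i.

(* 0 <= m_1 <= ... <= m_r < N, the bound N being carried by the type. *)
Definition nondecreasing_tuple N (m : r.-tuple 'I_N) : bool :=
  sorted leq (map val m).

(* m_r, for r > 0. *)
Definition last_entry N (m : r.-tuple 'I_N) : nat := last 0%N (map val m).

(* The coefficient of z^N collects the finitely many chains with m_r = N. *)
Definition hurwitz_lerch k a : fps F := fun N =>
  \sum_(m : r.-tuple 'I_N.+1 | nondecreasing_tuple m && (last_entry m == N))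
     (hl_denom k a m)^-1.

(* Phi_k(1 - e^{-t}, a) *)
Definition hurwitz_lerch_subst k a : fps F :=
  fps_comp (hurwitz_lerch k a) (fps_sub (fps_one F) (fps_expS (-1))).

(* B_{n,a}^{(k)} as a polynomial in x = 'X: the generating function
   Phi_k(1 - e^{-t}, a) e^{r x t} is a power series in t over F[x]. *)
Definition multi_poly_bernoulli k a (n : nat) : {poly F} :=
  egf_coef
    (fps_mul (fun j => (hurwitz_lerch_subst k a j)%:P)
             (fps_expS (r%:R * 'X))) n.

End HurwitzLerch.

(* Main.v *)
Require Import Defs.
From HB Require Import structures.
From mathcomp Require Import all_boot all_order all_algebra.
From mathcomp Require Import reals complex.
Import Order.TTheory GRing.Theory Num.Theory.
Local Open Scope ring_scope.
Local Open Scope complex_scope.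

(** Write g = 1 - e^{-t}.  The coefficient of z^j in Phi_k(z, a) collects the
    chains with m_r = j, and since ((e^{-t} - 1) / (-1))^j = g^j, the number
    j! W_{-1,rx}(n, j) is the coefficient of t^n / n! in g^j e^{rxt}.  Hence
    both sides are the sum over the chains, grouped according to j = m_r. *)

Lemma eq_fps_exp (A : comUnitRingType) (f g : fps A) (j : nat) :
  f =1 g -> fps_exp f j =1 fps_exp g j.
Proof.
move=> fg; elim: j => // j IHj n; apply: eq_bigr => i _.
by rewrite fg; congr (_ * _); apply: IHj.
Qed.

(** The added terms have [i < j] and vanish, since [g ^ j] has no term of degree below [j]. A bound
    independent of [i] lets the sums be exchanged in a product. *)
Lemma fps_comp_widen (A : comUnitRingType) (f g : fps A) (i n : nat) :
  g 0%N = 0 -> (i <= n)%N ->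
  fps_comp f g i = \sum_(j < n.+1) f j * fps_exp g j i.
Proof.
move=> g0 le_in; rewrite /fps_comp (big_ord_widen n.+1 (fun j => f j * fps_exp g j i)) //.
rewrite [RHS](bigID (fun j : 'I_n.+1 => (j < i.+1)%N)) /= [X in _ + X]big1 ?addr0 //.
by move=> j; rewrite -leqNgt => lt_ij; rewrite fps_exp_small ?mulr0.
Qed.

Lemma fps_mul_compl (A : comUnitRingType) (f g h : fps A) (n : nat) :
  g 0%N = 0 ->
  fps_mul (fps_comp f g) h n =
    \sum_(j < n.+1) f j * fps_mul h (fps_exp g j) n.
Proof.
move=> g0; rewrite /fps_mul.
under eq_bigr => i _ do rewrite (@fps_comp_widen _ _ _ i n) ?leq_ord // mulr_suml.
rewrite exchange_big; apply: eq_bigr => j _; rewrite mulr_sumr.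
(* Replacing [i] by [n - i] makes [h] the left factor, the order used in [r_whitney2]. *)
rewrite (reindex_inj rev_ord_inj) /=; apply: eq_bigr => i _.
by rewrite !subSS subKn ?leq_ord // -mulrA [X in f j * X]mulrC.
Qed.

Lemma fact_r_whitney2N1 (F : numFieldType) (rho : F) (n j : nat) :
  j`!%:R * r_whitney2 (-1) rho n j =
    n`!%:R * fps_mul (fps_expS rho)
               (fps_exp (fps_sub (fps_one F) (fps_expS (-1))) j) n.
Proof.
(* Cancelling [j!] against its inverse uses characteristic zero. *)
rewrite /r_whitney2 /egf_coef /fps_scale mulrCA mulVKf; last first.
  by rewrite pnatr_eq0 -lt0n fact_gt0.
congr (_ * _); apply: eq_bigr => i _; congr (_ * _); apply: eq_fps_exp => l.
by rewrite /fps_sub invrN1 mulN1r opprB.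
Qed.

(** Evaluation is a ring morphism fixing constants, and the inverted factorials are constant
    polynomials, so only ['X] in the exponential is affected. *)
Lemma horner_multi_poly_bernoulli (F : fieldType) (r : nat) (k : r.-tuple int)
    (a : F) (n : nat) (x : F) :
  (multi_poly_bernoulli k a n).[x] =
    n`!%:R * fps_mul (hurwitz_lerch_subst k a) (fps_expS (x * r%:R)) n.
Proof.
rewrite /multi_poly_bernoulli /egf_coef /fps_mul -(polyC_natr F n`!) hornerCM.
congr (_ * _); rewrite horner_sum; apply: eq_bigr => i _.
rewrite hornerCM /fps_expS -(polyC_natr F (n - i)`!) polyCV [X in X.[x]]mulrC hornerCM.
by rewrite horner_exp -(polyC_natr F r) hornerCM hornerX (mulrC x) (mulrC _^-1).
Qed.

Lemma nondecreasing_tuple_le_last (r N : nat) (m : r.-tuple 'I_N) (i : 'I_r) :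
  nondecreasing_tuple m -> (tnth m i <= last_entry m)%N.
Proof.
rewrite /nondecreasing_tuple /last_entry => m_sorted.
have lt_ir : (i < size (map val m))%N by rewrite size_map size_tuple.
have -> : tnth m i = nth 0%N (map val m) i :> nat.
  by rewrite (tnth_nth (tnth m i)) (nth_map (tnth m i)) // size_tuple.
rewrite -nth_last (sorted_leq_nth leq_trans leqnn) ?inE //.
  by rewrite ltn_predL (leq_trans _ lt_ir).
by rewrite -ltnS (ltn_predK lt_ir).
Qed.

(** A chain ending at [j] has all its entries at most [j], so enlarging the range of the entries to
    [n] creates no new chain. This puts the chains for all [j] in one type. *)
Lemma hurwitz_lerch_widen (F : fieldType) (r : nat) (k : r.-tuple int) (a : F)
    (j n : nat) :
  (j <= n)%N ->
  hurwitz_lerch k a j =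
    \sum_(m : r.-tuple 'I_n.+1 | nondecreasing_tuple m && (last_entry m == j))
      (hl_denom k a m)^-1.
Proof.
move=> le_jn; have le_jn1 : (j.+1 <= n.+1)%N by [].
pose widen (m : r.-tuple 'I_j.+1) := map_tuple (widen_ord le_jn1) m.
(* [inord] sends an entry above [j] to the default 0, but a chain ending at [j] has no such
   entry. *)
pose narrow (m : r.-tuple 'I_n.+1) := map_tuple (fun i : 'I_n.+1 => inord i : 'I_j.+1) m.
have widenE m : map val (widen m) = map val m by rewrite -map_comp; apply: eq_map.
rewrite [RHS](reindex_onto widen narrow) => [|m /andP[m_nd /eqP last_m]].
  apply: eq_big => [m|m _].
    rewrite /nondecreasing_tuple /last_entry widenE.
    suff -> : narrow (widen m) = m by rewrite eqxx andbT.
    by apply: eq_from_tnth => i; rewrite !tnth_map; apply: val_inj; rewrite /= inord_val.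
  by congr (_^-1); apply: eq_bigr => i _; rewrite tnth_map.
apply: eq_from_tnth => i; rewrite !tnth_map; apply: val_inj => /=.
by rewrite inordK // ltnS -last_m nondecreasing_tuple_le_last.
Qed.

Lemma last_entry_lt (r N : nat) (m : r.-tuple 'I_N.+1) : (last_entry m < N.+1)%N.
(* The default 0 of [last] is the value of [ord0], so the bound covers the empty tuple too. *)
Proof. by rewrite /last_entry (last_map val m ord0) ltn_ord. Qed.

Theorem theorem3p1 (R : realType) (r : nat) (hr : (1 <= r)%N)
    (k : r.-tuple int) (a : R[i])
    (ha : forall j : int, j <= r%:Z - 1 -> a != j%:~R)
    (n : nat) (x : R[i]) :
  (multi_poly_bernoulli k a n).[x] =
    \sum_(m : r.-tuple 'I_n.+1 | nondecreasing_tuple m)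
      (last_entry m)`!%:R * r_whitney2 (-1) (x * r%:R) n (last_entry m)
        / hl_denom k a m.
Proof.
rewrite horner_multi_poly_bernoulli fps_mul_compl; last first.
  by rewrite /fps_sub /fps_one /fps_expS expr0 fact0 divr1 subrr.
rewrite mulr_sumr.
rewrite [RHS](partition_big (fun m => Ordinal (last_entry_lt _ _ m)) xpredT) //=.
apply: eq_bigr => j _; rewrite mulrCA -fact_r_whitney2N1.
(* Both sides now sum over chains in ['I_n.+1] with last entry [j]. *)
rewrite (@hurwitz_lerch_widen _ _ _ _ _ _ (leq_ord j)) mulr_suml.
apply: eq_big => [m|m /andP[_ /eqP ->]]; first by rewrite -val_eqE.
exact: mulrC.
Qed.
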